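(* For every $r\in\mathbb N$, all coefficients of the $q$-series expansion of \[ (-q;q^2)_\infty\left(\sum_{k=0}^{\infty}\frac{q^{2(2kr+1)}}{1-q^{2(2kr+1)}}-\sum_{k=1}^{\infty}\frac{q^{2kr}}{1-q^{4kr}}\right) \] are non-negative.
   Context: $(a;q)_\infty:=\prod_{j=0}^\infty(1-aq^j)$; series are formal power series in $q$. *)

(* Defs.v *)
From HB Require Import structures.
From mathcomp Require Import all_boot all_order all_algebra.
From mathcomp Require Import boolp classical_sets.

Set Implicit Arguments.
Unset Strict Implicit.
Unset Printing Implicit Defensive.

Import Order.TTheory GRing.Theory Num.Theory.
Local Open Scope ring_scope.

(* The record prevents a clash with the pointwise ring structure on functions. *)
Record fps (R : Type) := Fps { fps_coef : nat -> R }.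

HB.instance Definition _ (R : Type) := gen_eqMixin (fps R).
HB.instance Definition _ (R : Type) := gen_choiceMixin (fps R).

Lemma fpsP (R : Type) (f g : fps R) :
  (forall n, fps_coef f n = fps_coef g n) -> f = g.
Proof. by case: f g => f [g] /= fg; congr Fps; apply/funext. Qed.

Section FpsRing.
Variable R : comNzRingType.
Implicit Types f g h : fps R.

Definition fps_zero : fps R := Fps (fun=> 0).
Definition fps_add f g : fps R := Fps (fun n => fps_coef f n + fps_coef g n).
Definition fps_opp f : fps R := Fps (fun n => - fps_coef f n).
Definition fps_one : fps R := Fps (fun n => (n == 0%N)%:R).
Definition fps_mul f g : fps R :=
  Fps (fun n => \sum_(i < n.+1) fps_coef f i * fps_coef g (n - i)).

Fact fps_addA : associative fps_add.
Proof. by move=> f g h; apply: fpsP => n /=; rewrite addrA. Qed.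

Fact fps_addC : commutative fps_add.
Proof. by move=> f g; apply: fpsP => n /=; rewrite addrC. Qed.

Fact fps_add0 : left_id fps_zero fps_add.
Proof. by move=> f; apply: fpsP => n /=; rewrite add0r. Qed.

Fact fps_addN : left_inverse fps_zero fps_opp fps_add.
Proof. by move=> f; apply: fpsP => n /=; rewrite addNr. Qed.

HB.instance Definition _ := GRing.isZmodule.Build (fps R)
  fps_addA fps_addC fps_add0 fps_addN.

Fact fps_mulC : commutative fps_mul.
Proof.
move=> f g; apply: fpsP => n /=.
rewrite (reindex_inj rev_ord_inj) /=; apply: eq_bigr => i _.
by rewrite subSS subKn ?leq_ord // mulrC.
Qed.

Fact fps_mulA : associative fps_mul.
Proof.
move=> f g h; apply: fpsP => i.
have rev f' g' n : fps_coef (fps_mul f' g') n =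
    \sum_(j < n.+1) fps_coef f' (n - j) * fps_coef g' j.
  by rewrite fps_mulC; apply: eq_bigr => j _; rewrite mulrC.
rewrite [RHS]rev [LHS]/=.
pose coef3 j k := fps_coef f j * (fps_coef g (i - j - k) * fps_coef h k).
transitivity (\sum_(j < i.+1) \sum_(k < i.+1 | (k <= i - j)%N) coef3 j k).
  apply: eq_bigr => /= j _; rewrite -[X in _ * X]/(fps_coef (fps_mul g h) _).
  rewrite rev big_distrr /=.
  by rewrite (big_ord_narrow_leq (leq_subr _ _)).
rewrite (exchange_big_dep predT) //=; apply: eq_bigr => k _.
transitivity (\sum_(j < i.+1 | (j <= i - k)%N) coef3 j k).
  apply: eq_bigl => j; rewrite -ltnS -(ltnS j) -!subSn ?leq_ord //.
  by rewrite -subn_gt0 -(subn_gt0 j) -!subnDA addnC.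
rewrite (big_ord_narrow_leq (leq_subr _ _)) big_distrl /=.
by apply: eq_bigr => j _; rewrite /coef3 -!subnDA addnC mulrA.
Qed.

Fact fps_mul1 : left_id fps_one fps_mul.
Proof.
move=> f; apply: fpsP => n /=; rewrite big_ord_recl /= mul1r subn0.
by rewrite big1 ?addr0 // => i _; rewrite /= mul0r.
Qed.

Fact fps_mulDl : left_distributive fps_mul fps_add.
Proof.
move=> f g h; apply: fpsP => n /=; rewrite -big_split /=.
by apply: eq_bigr => i _; rewrite mulrDl.
Qed.

Fact fps_one_neq0 : fps_one != 0.
Proof.
apply/eqP => /(congr1 (fun f => fps_coef f 0%N)) /= /eqP.
by rewrite (oner_eq0 R).
Qed.

HB.instance Definition _ := GRing.Zmodule_isComNzRing.Build (fps R)
  fps_mulA fps_mulC fps_mul1 fps_mulDl fps_one_neq0.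

Definition fpsX : fps R := Fps (fun n => (n == 1%N)%:R).

Lemma fps_coef0 n : fps_coef (0 : fps R) n = 0. Proof. by []. Qed.
Lemma fps_coef1 n : fps_coef (1 : fps R) n = (n == 0%N)%:R. Proof. by []. Qed.
Lemma fps_coefD f g n : fps_coef (f + g) n = fps_coef f n + fps_coef g n.
Proof. by []. Qed.
Lemma fps_coefN f n : fps_coef (- f) n = - fps_coef f n. Proof. by []. Qed.
Lemma fps_coefM f g n :
  fps_coef (f * g) n = \sum_(i < n.+1) fps_coef f i * fps_coef g (n - i).
Proof. by []. Qed.

Lemma fps_coef_sum (I : Type) (s : seq I) (P : pred I) (F : I -> fps R) n :
  fps_coef (\sum_(i <- s | P i) F i) n = \sum_(i <- s | P i) fps_coef (F i) n.
Proof. by elim/big_rec2: _ => //= i a b _ <-. Qed.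

Lemma fps_coefXM f n :
  fps_coef (fpsX * f) n = if n is n'.+1 then fps_coef f n' else 0.
Proof.
rewrite fps_coefM big_ord_recl /= mul0r add0r.
case: n => [|n]; first by rewrite big_ord0.
rewrite big_ord_recl /= mul1r subSS subn0 big1 ?addr0 // => i _.
by rewrite /= mul0r.
Qed.

Lemma fps_coefXnM f m n :
  fps_coef (fpsX ^+ m * f) n = if (n < m)%N then 0 else fps_coef f (n - m).
Proof.
elim: m n => [|m IHm] n; first by rewrite mul1r subn0.
by rewrite exprS -mulrA fps_coefXM; case: n => [|n] //; rewrite IHm ltnS subSS.
Qed.

Lemma fps_coefXn m n : fps_coef (fpsX ^+ m) n = (n == m)%:R.
Proof.
rewrite -[_ ^+ m]mulr1 fps_coefXnM fps_coef1 subn_eq0.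
by case: ltngtP.
Qed.

End FpsRing.

Arguments fpsX {R}.

Section FpsUnit.
Variable R : comUnitRingType.
Implicit Types f g : fps R.

Fixpoint fps_inv_seq f n : seq R :=
  if n is n'.+1 then
    let s := fps_inv_seq f n' in
    rcons s (- (fps_coef f 0%N)^-1 *
             \sum_(i < n'.+1) fps_coef f i.+1 * s`_(n' - i))
  else [:: (fps_coef f 0%N)^-1].

Definition fps_unit f : bool := fps_coef f 0%N \is a GRing.unit.

Definition fps_inv f : fps R :=
  if fps_unit f then Fps (fun n => (fps_inv_seq f n)`_n) else f.

Fact size_fps_inv_seq f n : size (fps_inv_seq f n) = n.+1.
Proof. by elim: n => //= n IHn; rewrite size_rcons IHn. Qed.

Fact nth_fps_inv_seq f n k :
  (k <= n)%N -> (fps_inv_seq f n)`_k = (fps_inv_seq f k)`_k.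
Proof.
elim: n => [|n IHn]; first by rewrite leqn0 => /eqP ->.
rewrite leq_eqVlt => /predU1P[-> //|]; rewrite ltnS => le_kn.
by rewrite /= nth_rcons size_fps_inv_seq ltnS le_kn IHn.
Qed.

Fact fps_mulVf : {in fps_unit, left_inverse 1 fps_inv *%R}.
Proof.
move=> f; rewrite unfold_in => f0u; rewrite /fps_inv [fps_unit f]f0u mulrC.
apply: fpsP => -[|n]; rewrite fps_coefM big_ord_recl /=.
  by rewrite big_ord0 addr0 divrr.
rewrite nth_rcons size_fps_inv_seq ltnn eqxx mulNr mulrN mulVKr //.
apply/eqP; rewrite addrC subr_eq0; apply/eqP/eq_bigr => i _.
by rewrite /bump /= add1n subSS [in RHS]nth_fps_inv_seq ?leq_subr.
Qed.

Fact fps_unitPl f g : g * f = 1 -> fps_unit f.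
Proof.
move=> /(congr1 (fun h => fps_coef h 0%N)).
rewrite fps_coefM big_ord1 fps_coef1 /= => gf1.
by apply/unitrPr; exists (fps_coef g 0%N); rewrite mulrC.
Qed.

Fact fps_inv_out : {in [predC fps_unit], fps_inv =1 id}.
Proof. by move=> f /negPf fu; rewrite /fps_inv [fps_unit f]fu. Qed.

HB.instance Definition _ := GRing.ComNzRing_hasMulInverse.Build (fps R)
  fps_mulVf fps_unitPl fps_inv_out.

Lemma fps_unitE f : (f \is a GRing.unit) = (fps_coef f 0%N \is a GRing.unit).
Proof. by []. Qed.

Lemma fps_unit_1subXn n : (0 < n)%N -> 1 - fpsX ^+ n \is a @GRing.unit (fps R).
Proof.
move=> n_gt0; rewrite fps_unitE fps_coefD fps_coefN fps_coefXn.
by rewrite fps_coef1 (ltn_eqF n_gt0) mulr0n subr0 unitr1.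
Qed.

End FpsUnit.

Arguments fps_coef : simpl never.

Section FpsLimit.
Variable R : comUnitRingType.
Implicit Types (u F : nat -> fps R) (f l : fps R).

(* Coefficientwise eventual stabilisation. *)
Definition fps_cvg u l : Prop :=
  forall n, exists N, forall m, (N <= m)%N -> fps_coef (u m) n = fps_coef l n.

(* Set to 0 when u diverges. *)
Definition fps_lim u : fps R := xget 0 [set l | fps_cvg u l]%classic.

Definition fps_sum (m : nat) F : fps R := fps_lim (fun N => \sum_(m <= k < N) F k).

Definition qpoch_inf (a q : fps R) : fps R :=
  fps_lim (fun N => \prod_(0 <= j < N) (1 - a * q ^+ j)).

Lemma fps_cvg_unique u l1 l2 : fps_cvg u l1 -> fps_cvg u l2 -> l1 = l2.
Proof.
move=> u1 u2; apply: fpsP => n; have [N1 E1] := u1 n; have [N2 E2] := u2 n.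
by rewrite -(E1 (maxn N1 N2)) ?leq_maxl // (E2 (maxn N1 N2)) ?leq_maxr.
Qed.

Lemma fps_lim_cvg u : (exists l, fps_cvg u l) -> fps_cvg u (fps_lim u).
Proof. exact: xgetPex. Qed.

Lemma fps_limE u l : fps_cvg u l -> fps_lim u = l.
Proof.
by move=> ul; apply: fps_cvg_unique (ul); apply: fps_lim_cvg; exists l.
Qed.

Lemma fps_stable_cvg u (N : nat -> nat) :
  (forall n m, (N n <= m)%N -> fps_coef (u m.+1) n = fps_coef (u m) n) ->
  exists l, fps_cvg u l.
Proof.
move=> uS; exists (Fps (fun n => fps_coef (u (N n)) n)) => n; exists (N n) => m.
move=> /subnKC <-; elim: (m - N n)%N => [|d IHd]; first by rewrite addn0.
by rewrite addnS uS ?leq_addr.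
Qed.

Lemma fps_sum_cvg m F (N : nat -> nat) :
  (forall n k, (N n <= k)%N -> fps_coef (F k) n = 0) ->
  fps_cvg (fun K => \sum_(m <= k < K) F k) (fps_sum m F).
Proof.
move=> F0; apply: fps_lim_cvg.
apply: (@fps_stable_cvg _ (fun n => maxn m (N n))) => n k.
rewrite geq_max => /andP[le_mk le_Nk].
by rewrite big_nat_recr //= fps_coefD F0 // addr0.
Qed.

Lemma qpoch_inf_cvg (a q : fps R) (N : nat -> nat) :
  (forall n k i, (N n <= k)%N -> (i <= n)%N -> fps_coef (a * q ^+ k) i = 0) ->
  fps_cvg (fun K => \prod_(0 <= j < K) (1 - a * q ^+ j)) (qpoch_inf a q).
Proof.
move=> aq0; apply: fps_lim_cvg; apply: (@fps_stable_cvg _ N) => n k le_Nk.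
rewrite big_nat_recr //= mulrBr mulr1 fps_coefD fps_coefN fps_coefM.
rewrite [X in _ - X]big1 ?subr0 // => i _.
by rewrite (aq0 n) ?mulr0 ?leq_subr.
Qed.

End FpsLimit.

(* No default value of fps_lim or ^-1 occurs in the series considered below. *)

Lemma qpoch_odd_cvg :
  fps_cvg (fun K => \prod_(0 <= j < K) (1 - (- fpsX) * (fpsX ^+ 2) ^+ j))
          (qpoch_inf (- fpsX) (fpsX ^+ 2) : fps int).
Proof.
apply: (@qpoch_inf_cvg _ _ _ id) => n k i le_nk le_in.
rewrite mulNr -exprM -exprS fps_coefN fps_coefXn.
by rewrite ltn_eqF ?oppr0 // ltnS (leq_trans le_in) // (leq_trans le_nk) ?leq_pmull.
Qed.

Lemma lambert1_cvg (r : nat) : (0 < r)%N ->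
  let F k := fpsX ^+ (2 * (2 * k * r + 1)) / (1 - fpsX ^+ (2 * (2 * k * r + 1))) in
  (forall k, 1 - fpsX ^+ (2 * (2 * k * r + 1)) \is a @GRing.unit (fps int)) /\
  fps_cvg (fun K => \sum_(0 <= k < K) F k) (fps_sum 0 F : fps int).
Proof.
move=> r_gt0 F; split=> [k|]; first by rewrite fps_unit_1subXn // muln_gt0 addn1.
apply: (@fps_sum_cvg _ _ _ id) => n k le_nk; rewrite fps_coefXnM ifT //.
rewrite (leq_ltn_trans le_nk) // (leq_trans _ (leq_pmull _ _)) //.
by rewrite addn1 ltnS mulnAC leq_pmull // muln_gt0.
Qed.

Lemma lambert2_cvg (r : nat) : (0 < r)%N ->
  let F k := fpsX ^+ (2 * k * r) / (1 - fpsX ^+ (4 * k * r)) in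
  (forall k, (0 < k)%N -> 1 - fpsX ^+ (4 * k * r) \is a @GRing.unit (fps int)) /\
  fps_cvg (fun K => \sum_(1 <= k < K) F k) (fps_sum 1 F : fps int).
Proof.
move=> r_gt0 F; split=> [k k_gt0|].
  by rewrite fps_unit_1subXn // !muln_gt0 k_gt0.
apply: (@fps_sum_cvg _ _ _ succn) => n k lt_nk; rewrite fps_coefXnM ifT //.
by rewrite (leq_trans lt_nk) // mulnAC leq_pmull // muln_gt0.
Qed.

(* Main.v *)
(** Let [d i] be the number of partitions of [i] into distinct odd parts, so
    that [(-q;q^2)_oo = \sum_i d i q^i].  Expanding the geometric series, and
    exchanging the two indices in the second sum, the coefficient of [q^n]
    becomes the sum over [j >= 0] and [m >= 1] of
      [d (n - 2m(2jr+1)) - d (n - 2m(2jr+r))].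
    Adding 2 to the largest part gives [d i <= d (i+2)] for [i > 0]; as
    [d 0 = d 4 = 1] and [d 2 = 0], every difference is nonnegative except when
    [r = 2], [m = 1] and [n = 8j+4], where it is [d 2 - d 0 = -1].  That single
    loss is compensated by the pair [j = 0], [m = n/2], whose difference is
    [d 0 = 1]. *)
Require Import Defs.
From mathcomp Require Import all_boot all_order all_algebra.
From mathcomp Require Import zify ring.
Import Order.TTheory GRing.Theory Num.Theory.
Local Open Scope ring_scope.

(** * Limits of power series and geometric expansions *)

Section Convergence.
Variable R : comUnitRingType.
Implicit Types (f g l : fps R) (u v : nat -> fps R).

Lemma fps_cvgB u v f g :
  fps_cvg u f -> fps_cvg v g -> fps_cvg (fun m => u m - v m) (f - g).
Proof.
move=> uf vg n; have [M EM] := uf n; have [N EN] := vg n.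
exists (maxn M N) => m; rewrite geq_max => /andP[leM leN].
by rewrite !fps_coefD !fps_coefN EM // EN.
Qed.

(** A coefficient of a product involves all lower coefficients of the factors, so [fps_cvgMl] needs
    one threshold for all of them. *)
Lemma fps_cvg_upto u l n : fps_cvg u l ->
  exists N, forall m i, (N <= m)%N -> (i <= n)%N ->
    fps_coef (u m) i = fps_coef l i.
Proof.
move=> ul; elim: n => [|n [N IHN]].
  by have [N EN] := ul 0%N; exists N => m [|i] // leN _; apply: EN.
have [M EM] := ul n.+1; exists (maxn M N) => m i.
rewrite geq_max => /andP[leM leN]; rewrite leq_eqVlt => /predU1P[->|].
  exact: EM.
exact: IHN.
Qed.

Lemma fps_cvgMl f u l : fps_cvg u l -> fps_cvg (fun m => f * u m) (f * l).
Proof.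
move=> ul n; have [N EN] := fps_cvg_upto _ _ n ul.
exists N => m leN; rewrite !fps_coefM; apply: eq_bigr => i _.
by rewrite EN ?leq_subr.
Qed.

Lemma fps_geomE a b K : (0 < b)%N ->
  fpsX ^+ a / (1 - fpsX ^+ b) =
  \sum_(m < K) fpsX ^+ (a + b * m) + fpsX ^+ (a + b * K) / (1 - fpsX ^+ b)
    :> fps R.
Proof.
move=> b_gt0; have ub := fps_unit_1subXn R b_gt0.
elim: K => [|K ->]; first by rewrite big_ord0 add0r muln0 addn0.
rewrite big_ord_recr /= -addrA; congr (_ + _); apply: (mulIr ub).
by rewrite mulrDl !mulrVK // mulrBr mulr1 -exprD mulnSr addnA subrK.
Qed.

(** The remainder of the geometric series starts in degree [a + b * K], beyond [n]. *)
Lemma fps_coef_mul_geom f a b K n : (0 < b)%N -> (n < a + b * K)%N ->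
  fps_coef (f * (fpsX ^+ a / (1 - fpsX ^+ b))) n =
  \sum_(m < K) fps_coef (fpsX ^+ (a + b * m) * f) n.
Proof.
move=> b_gt0 ltnK; rewrite (fps_geomE _ _ K) // mulrDr fps_coefD mulr_sumr.
rewrite mulrCA fps_coefXnM ltnK addr0 fps_coef_sum.
by apply: eq_bigr => m _; rewrite mulrC.
Qed.

End Convergence.

(** * Partitions into distinct odd parts *)

Definition odd_prod K : fps int := \prod_(0 <= j < K) (1 + fpsX ^+ j.*2.+1).

Lemma odd_prod0 : odd_prod 0 = 1.
Proof. by rewrite /odd_prod big_nil. Qed.

Lemma odd_prodS K : odd_prod K.+1 = odd_prod K + fpsX ^+ K.*2.+1 * odd_prod K.
Proof. by rewrite /odd_prod big_nat_recr //= mulrDr mulr1 [_ * fpsX ^+ _]mulrC. Qed.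

Lemma coef_odd_prod_ge0 K n : 0 <= fps_coef (odd_prod K) n.
Proof.
elim: K n => [|K IHK] n; first by rewrite odd_prod0 fps_coef1 ler0n.
by rewrite odd_prodS fps_coefD fps_coefXnM addr_ge0 //; case: ifP.
Qed.

Lemma coef_odd_prod_le K L n :
  (K <= L)%N -> fps_coef (odd_prod K) n <= fps_coef (odd_prod L) n.
Proof.
move=> /subnKC <-; elim: (L - K)%N => [|s IHs]; first by rewrite addn0.
rewrite addnS odd_prodS fps_coefD fps_coefXnM (le_trans IHs) // lerDl.
by case: ifP => // _; apply: coef_odd_prod_ge0.
Qed.

Lemma coef0_odd_prod K : fps_coef (odd_prod K) 0 = 1.
Proof.
elim: K => [|K IHK]; first by rewrite odd_prod0 fps_coef1.
by rewrite odd_prodS fps_coefD fps_coefXnM IHK addr0.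
Qed.

(* Splitting by the largest part, [P = odd_prod K] satisfies
   [P = 1 + \sum_(k < K) q^(2k+1) odd_prod k]; the summand [q^2] repairs the
   empty partition, which has no largest part, and the last one the truncation
   of the product. *)
Lemma coef_odd_prod_incr K n :
  0 <= fps_coef ((1 - fpsX ^+ 2) * odd_prod K + fpsX ^+ 2
                 + fpsX ^+ K.*2.+1 * odd_prod K) n.
Proof.
elim: K n => [|K IHK] n.
  rewrite odd_prod0 !mulr1 subrK fps_coefD fps_coef1 fps_coefXn.
  by rewrite addr_ge0 ?ler0n.
have -> : (1 - fpsX ^+ 2) * odd_prod K.+1 + fpsX ^+ 2
            + fpsX ^+ K.+1.*2.+1 * odd_prod K.+1
        = (1 - fpsX ^+ 2) * odd_prod K + fpsX ^+ 2
            + fpsX ^+ K.*2.+1 * odd_prod K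
            + fpsX ^+ (K.*2.+3 + K.*2.+1) * odd_prod K.
  rewrite odd_prodS doubleS exprD.
  have -> : fpsX ^+ K.*2.+3 = fpsX ^+ 2 * fpsX ^+ K.*2.+1 :> fps int.
    by rewrite -exprD.
  by ring.
rewrite fps_coefD addr_ge0 // fps_coefXnM; case: ifP => // _.
exact: coef_odd_prod_ge0.
Qed.

Definition distinct_odd : fps int := qpoch_inf (- fpsX) (fpsX ^+ 2).

Lemma coef_distinct_oddE n :
  exists N, forall K, (N <= K)%N ->
    fps_coef distinct_odd n = fps_coef (odd_prod K) n.
Proof.
have [N EN] := qpoch_odd_cvg n; exists N => K leNK.
rewrite -(EN K) // /odd_prod; congr (fps_coef _ _); apply: eq_bigr => j _.
by rewrite mulNr opprK -exprM -exprS mul2n.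
Qed.

Lemma coef_distinct_odd_ge0 n : 0 <= fps_coef distinct_odd n.
Proof.
by have [N /(_ N (leqnn _)) ->] := coef_distinct_oddE n; apply: coef_odd_prod_ge0.
Qed.

Lemma coef0_distinct_odd : fps_coef distinct_odd 0 = 1.
Proof.
by have [N /(_ N (leqnn _)) ->] := coef_distinct_oddE 0; apply: coef0_odd_prod.
Qed.

Lemma coef4_distinct_odd_ge1 : 1 <= fps_coef distinct_odd 4.
Proof.
(* Two factors suffice: [(1 + q)(1 + q^3)] already contains [q^4]. *)
have [N /(_ (maxn N 2) (leq_maxl _ _)) ->] := coef_distinct_oddE 4.
apply: le_trans (coef_odd_prod_le 2 _ 4 (leq_maxr _ _)).
rewrite !odd_prodS odd_prod0 !mulr1 !(fps_coefD, mulrDr, mulr1, =^~ exprD).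
by rewrite fps_coef1 !fps_coefXn.
Qed.

Lemma coef_distinct_odd_leSS n :
  (0 < n)%N -> fps_coef distinct_odd n <= fps_coef distinct_odd n.+2.
Proof.
move=> n_gt0; have [N EN] := coef_distinct_oddE n.
have [M EM] := coef_distinct_oddE n.+2; set K := maxn n.+2 (maxn N M).
have [leNK leMK lenK] : [/\ (N <= K)%N, (M <= K)%N & (n.+2 <= K)%N].
  by rewrite /K; split; lia.
rewrite (EN K) // (EM K) //; have := coef_odd_prod_incr K n.+2.
rewrite mulrBl mul1r !fps_coefD fps_coefN !fps_coefXnM fps_coefXn.
(* The truncation term starts beyond degree [n + 2], and [n > 0] keeps the repair term [q^2] out of
   it. *)
rewrite (_ : n.+2 < K.*2.+1)%N; last by lia.
by rewrite /= subSS subn1 /= !eqSS (gtn_eqF n_gt0) !addr0 subr_ge0.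
Qed.

Lemma coef_distinct_odd_le n s : (0 < n)%N || (s != 1)%N ->
  fps_coef distinct_odd n <= fps_coef distinct_odd (n + s.*2).
Proof.
have pos t m : (0 < m)%N ->
    fps_coef distinct_odd m <= fps_coef distinct_odd (m + t.*2).
  move=> m_gt0; elim: t => [|t IHt]; first by rewrite addn0.
  by rewrite doubleS !addnS (le_trans IHt) // coef_distinct_odd_leSS // addn_gt0 m_gt0.
case: n => [|n]; last by move=> _; apply: pos.
(* From 0 the chain skips index 2, where the coefficient drops to 0, and restarts at 4. *)
case: s => [|[|s]] // _; rewrite coef0_distinct_odd !doubleS add0n.
by rewrite (le_trans coef4_distinct_odd_ge1) // (pos s 4%N).
Qed.

(** * Termwise comparison of the double sums *)

(** This is [d (n - a)], but 0 for [a > n], where truncated subtraction would give [d 0]. *)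
Definition shifted n a : int := fps_coef (fpsX ^+ a * distinct_odd) n.

Lemma shifted_ge0 n a : 0 <= shifted n a.
Proof.
by rewrite /shifted fps_coefXnM; case: ifP => // _; apply: coef_distinct_odd_ge0.
Qed.

Lemma shifted_diag n : shifted n n = 1.
Proof. by rewrite /shifted fps_coefXnM ltnn subnn coef0_distinct_odd. Qed.

Lemma shifted_gt n a : (n < a)%N -> shifted n a = 0.
Proof. by rewrite /shifted fps_coefXnM => ->. Qed.

Lemma shifted_le n a s :
  (a + s.*2 != n)%N || (s != 1)%N -> shifted n (a + s.*2) <= shifted n a.
Proof.
move=> H; case: (ltnP n (a + s.*2)) => [lt|le].
  by rewrite (shifted_gt _ _ lt) shifted_ge0.
rewrite /shifted !fps_coefXnM !ifF; try lia.
rewrite (_ : n - a = n - (a + s.*2) + s.*2)%N; last by lia.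
by apply: coef_distinct_odd_le; lia.
Qed.

Lemma shifted_leS2 n a : shifted n a.+2 <= shifted n a + (a.+2 == n)%:R.
Proof.
case: eqP => [<-|/eqP ne]; first by rewrite shifted_diag lerDr shifted_ge0.
by rewrite addr0 -addn2 (shifted_le _ _ 1) // addn2 ne.
Qed.

(* Here and below [m] is one less than the multiplier [m] of the header. *)
Definition gain r n j m : bool :=
  (r == 2)%N && (n %% 8 == 4)%N && (j == 0)%N && (m.+1.*2 == n)%N.

Definition loss r n j m : bool :=
  (r == 2)%N && (8 * j + 4 == n)%N && (m == 0)%N.

Lemma shifted_diff_ge r n j m : (0 < r)%N ->
  ((gain r n j m)%:R - (loss r n j m)%:R : int)
  <= shifted n (2 * (2 * j * r + 1) * m.+1) - shifted n (2 * m.+1 * r * (2 * j + 1)).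
Proof.
rewrite /gain /loss => r_gt0.
(* Half the gap between the exponents is [(m + 1)(r - 1)], which is 1 only for [m = 0] and
   [r = 2]. *)
have e : (2 * m.+1 * r * (2 * j + 1) = 2 * (2 * j * r + 1) * m.+1 + (m.+1 * r.-1).*2)%N.
  by case: r r_gt0 => // r _; rewrite -muln2 /=; nia.
case: (boolP (_ && (m.+1.*2 == n)%N)) => [/andP[/andP[/andP[/eqP r2 n4] /eqP j0] /eqP mn]|_].
  (* The exponents are [n] and [2n], so the difference is [d 0 = 1]; [m = 0] would give [n = 2], so
     this pair is no loss. *)
  subst r j; rewrite (_ : 2 * (2 * 0 * 2 + 1) * m.+1 = n)%N; last by lia.
  rewrite shifted_diag shifted_gt; last by lia.
  by rewrite (_ : (m == 0)%N = false) ?andbF //; lia.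
rewrite sub0r lerBrDl {}e; case: andP => [[/andP[/eqP r2 /eqP jn] /eqP m0]|ne].
  subst r m; rewrite (_ : (1 * 2.-1).*2 = 2)%N // addn2.
  by have := shifted_leS2 n (2 * (2 * j * 2 + 1) * 1); lia.
rewrite subr0; apply: shifted_le; apply: contra_notT ne.
rewrite negb_or !negbK => /andP[/eqP en /eqP e1].
have [m0 r2] : m = 0%N /\ r = 2%N by nia.
by subst m r; split=> //; apply/andP; split=> //; apply/eqP; lia.
Qed.

(** It suffices to count pairs: [n] determines the loss pair, and whenever one exists, [j = 0],
    [m = n/2 - 1] is a gain pair within range. *)
Lemma sum_shifted_ge0 r n J M : (0 < r)%N -> (n < J)%N -> (n < M)%N ->
  0 <= \sum_(j < J) \sum_(m < M)
    (shifted n (2 * (2 * j * r + 1) * m.+1) - shifted n (2 * m.+1 * r * (2 * j + 1))).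
Proof.
move=> r_gt0 ltnJ ltnM.
rewrite pair_bigA /=.
apply: le_trans (ler_sum _ _
  (F := fun p : 'I_J * 'I_M => (gain r n p.1 p.2)%:R - (loss r n p.1 p.2)%:R)); last first.
  by move=> [j m] _; apply: shifted_diff_ge.
rewrite sumrB -!natr_sum -!big_mkcond /= !sum1dep_card subr_ge0 ler_nat.
have [->|[p]] := set_0Vmem [set p : 'I_J * 'I_M | loss r n p.1 p.2];
  first by rewrite cards0.
rewrite inE => /andP[/andP[/eqP r2 /eqP np] /eqP p0].
apply: (@leq_trans 1%N).
  apply/card_le1_eqP => -[j m] [j' m']; rewrite !inE /loss /=.
  move=> /andP[/andP[_ /eqP nj] /eqP m0] /andP[/andP[_ /eqP nj'] /eqP m0'].
  by congr (_, _); apply: ord_inj; lia.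
have lt0J : (0 < J)%N by lia.
have ltmM : (n./2.-1 < M)%N by lia.
apply/card_gt0P; exists (Ordinal lt0J, Ordinal ltmM).
by rewrite inE /gain r2 /=; apply/andP; split; lia.
Qed.

(** * Coefficients of the two Lambert series *)

Lemma coef_lambert1 r n j K : (n < K)%N ->
  fps_coef (distinct_odd * (fpsX ^+ (2 * (2 * j * r + 1)) /
                            (1 - fpsX ^+ (2 * (2 * j * r + 1))))) n =
  \sum_(m < K) shifted n (2 * (2 * j * r + 1) * m.+1).
Proof.
move=> ltnK; rewrite (@fps_coef_mul_geom _ _ _ _ K) ?muln_gt0 ?addn1 //.
  by apply: eq_bigr => m _; rewrite -mulnS.
by rewrite ltn_addl // (leq_trans ltnK) // leq_pmull.
Qed.

(** With [x = q^(2(m+1)r)] the term is [x / (1 - x^2)], the sum of the odd powers of [x]. *)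
Lemma coef_lambert2 r n m K : (0 < r)%N -> (n < K)%N ->
  fps_coef (distinct_odd * (fpsX ^+ (2 * m.+1 * r) /
                            (1 - fpsX ^+ (4 * m.+1 * r)))) n =
  \sum_(j < K) shifted n (2 * m.+1 * r * (2 * j + 1)).
Proof.
move=> r_gt0 ltnK; rewrite (@fps_coef_mul_geom _ _ _ _ K) ?muln_gt0 //.
  apply: eq_bigr => j _; rewrite /shifted.
  by congr (fps_coef (_ ^+ _ * _) _); ring.
by rewrite ltn_addl // (leq_trans ltnK) // leq_pmull // muln_gt0.
Qed.

Theorem theorem6p1 (r : nat) (hr : (0 < r)%N) :
  let q : fps int := fpsX in
  forall n : nat,
    0 <= fps_coef
      (qpoch_inf (- q) (q ^+ 2) *
       (fps_sum 0 (fun k => q ^+ (2 * (2 * k * r + 1)) /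
                            (1 - q ^+ (2 * (2 * k * r + 1))))
        - fps_sum 1 (fun k => q ^+ (2 * k * r) / (1 - q ^+ (4 * k * r))))) n.
Proof.
move=> q n; rewrite -[qpoch_inf _ _]/distinct_odd.
have [_ cvg1] := lambert1_cvg hr; have [_ cvg2] := lambert2_cvg hr.
have [N EN] := fps_cvgMl _ distinct_odd _ _ (fps_cvgB _ _ _ _ _ cvg1 cvg2) n.
have [K leNK ltnK] : exists2 K, (N <= K.+1)%N & (n < K)%N.
  by exists (maxn N n.+1); lia.
rewrite -(EN K.+1) // mulrBr fps_coefD fps_coefN !mulr_sumr !fps_coef_sum.
rewrite big_mkord big_add1 big_mkord /=.
(* The second sum starts at 1 and so has one term fewer; expanding to lengths [K] and [K.+1] puts
   both double sums on the same rectangle. *)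
under eq_bigr => j _ do rewrite (coef_lambert1 _ _ _ K) //.
under [X in _ - X]eq_bigr => m _ do rewrite (coef_lambert2 _ _ _ K.+1 hr (ltnW ltnK)).
rewrite [X in _ - X]exchange_big /= -sumrB.
under eq_bigr => j _ do rewrite -sumrB.
by apply: sum_shifted_ge0 => //; apply: ltnW.
Qed.
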